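(* Let $l\ge 1$ and let $A$ be an $l\times l$ Jordan block over $\mathbb{C}$ with an eigenvalue $\lambda$ satisfying $|\lambda|>1$, acting on $\mathbb{C}^l$. For $x\in\mathbb{C}^l$ let $J(x)$ be the extended limit set of $x$ under $A$. (i) If $x\neq 0$ then $J(x)=\emptyset$. (ii) If $x=0$ then $J(0)=\mathbb{C}^l$.
   Context: An $l\times l$ Jordan block with eigenvalue $\lambda$ is the matrix with all main diagonal entries equal to $\lambda$, all entries on the diagonal just above the main diagonal equal to $1$, and all other entries $0$. The extended limit set of $x\in\mathbb{C}^l$ under $A$ is $J(x)=\{y\in\mathbb{C}^l:$ there exist a strictly increasing sequence of positive integers $\{k_n\}$ and a sequence $\{x_n\}\subset\mathbb{C}^l$ such that $x_n\to x$ and $A^{k_n}x_n\to y\}$. *)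

(* Defs.v *)
From mathcomp Require Import all_boot all_order all_algebra.
From mathcomp Require Import complex.
From mathcomp Require Import classical_sets reals topology normedtype sequences.
Set Implicit Arguments.
Unset Strict Implicit.
Unset Printing Implicit Defensive.
Import Order.TTheory GRing.Theory Num.Theory.
Import numFieldNormedType.Exports.
Local Open Scope classical_set_scope.
Local Open Scope ring_scope.

Definition jordan_block (K : nzRingType) (l : nat) (lambda : K) : 'M[K]_l :=
  \matrix_(i < l, j < l)
    (if j == i then lambda else if j == i.+1 :> nat then 1 else 0).

(* The topology on ['cV[K]_l] is the product topology, which for K = C is the
   usual topology of C^l. *)
Definition extended_limit_set (K : numFieldType) (l : nat)
    (A : 'M[K]_l) (x : 'cV[K]_l) : set 'cV[K]_l :=
  [set y | exists (k : nat -> nat) (u : nat -> 'cV[K]_l),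
     [/\ forall n, (0 < k n)%N,
         {homo k : m n / (m < n)%N},
         u n @[n --> \oo] --> x &
         (A ^+ k n *m u n) @[n --> \oo] --> y]].

(* Main.v *)
Require Import Defs.
From mathcomp Require Import all_boot all_order all_algebra.
From mathcomp Require Import complex.
From mathcomp Require Import classical_sets reals topology normedtype sequences.
From mathcomp Require Import interval_inference ring.
Set Implicit Arguments.
Unset Strict Implicit.
Unset Printing Implicit Defensive.
Import Order.TTheory GRing.Theory Num.Theory.
Import numFieldNormedType.Exports.
Local Open Scope classical_set_scope.
Local Open Scope ring_scope.

(** The block expands: after a diagonal change of coordinates its off-diagonal
    entries become arbitrarily small, so in a suitable norm every vector is
    stretched by a factor [c > 1].  Back in the sup norm this reads
    [c ^+ k * `|v| <= C * `|A ^+ k *m v|] for all [k] and [v], with [C] a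
    constant ([jordan_block_expanding]).

    Consequently a sequence [u n] whose images [A ^+ k n *m u n] converge must
    tend to [0], since it is bounded by [c ^- k n] times a convergent sequence
    ([cvg0_of_expanding]).  Hence only [x = 0] can have extended limit points.
    Conversely [A] is invertible, and the preimages of a fixed [y] under the
    powers of [A] form a sequence with constant images, which the same lemma
    forces to tend to [0]; so every [y] belongs to the set of [0]. *)

(** The l1 norm after the change of coordinates by the diagonal matrix of the
    powers of [q], which turns the off-diagonal entries [1] of a Jordan block
    into [q^-1]. The l1 norm is additive in the coordinates, which makes shifting
    them easy to control. *)
Definition weighted_norm (K : numDomainType) (q : K) (l : nat)
    (v : 'cV[K]_l) : K :=
  \sum_(i < l) q ^+ i * `|v i 0|.

Lemma coord_le_mx_norm (K : numDomainType) (m n : nat) (A : 'M[K]_(m, n)) i j :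
  `|A i j| <= `|A|.
Proof.
rewrite [X in _ <= X]/Num.norm/= mx_normE -[X in X <= _]nngE num_le.
exact: (le_bigmax _ (fun p : 'I_m * 'I_n => `|A p.1 p.2|%:nng%R) (i, j)).
Qed.

Lemma weighted_norm_ge0 (K : numDomainType) (q : K) (l : nat) (v : 'cV[K]_l) :
  0 <= q -> 0 <= weighted_norm q v.
Proof. by move=> q0; apply: sumr_ge0 => i _; rewrite mulr_ge0 ?exprn_ge0. Qed.

Lemma weighted_norm_le (K : numDomainType) (q : K) (l : nat) (v : 'cV[K]_l) :
  0 <= q -> weighted_norm q v <= (\sum_(i < l) q ^+ i) * `|v|.
Proof.
move=> q0; rewrite mulr_suml; apply: ler_sum => i _.
by apply: ler_wpM2l; rewrite ?exprn_ge0// coord_le_mx_norm.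
Qed.

Lemma le_weighted_norm (K : numDomainType) (q : K) (l : nat) (v : 'cV[K]_l) :
  1 <= q -> `|v| <= weighted_norm q v.
Proof.
move=> q1; have q0 : 0 <= q by apply: le_trans q1.
have [->|v0] := eqVneq `|v| 0; first exact: weighted_norm_ge0.
have [[i j]/= vE] := mx_norm_neq0 v0.
rewrite [X in X <= _]vE ord1 /weighted_norm (bigD1 i)//= -[X in X <= _]addr0.
apply: lerD; first by rewrite ler_peMl// exprn_ege1.
by apply: sumr_ge0 => k _; rewrite mulr_ge0 ?exprn_ge0.
Qed.

Lemma jordan_block_split (K : nzRingType) (l : nat) (lambda : K) :
  jordan_block l lambda = lambda%:M + jordan_block l 0.
Proof.
apply/matrixP => i j; rewrite !mxE (eq_sym j i).
by have [ij|ij] := eqVneq i j; rewrite ?mulr1n ?mulr0n ?addr0 ?add0r.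
Qed.

(** The nilpotent part moves the entry of index [i.+1] to index [i], where its
    weight is [q] times smaller; the entry of index [0] is lost. *)
Lemma weighted_norm_nilpotent (K : numFieldType) (q : K) (l : nat)
    (v : 'cV[K]_l) :
  0 < q ->
  q * weighted_norm q (jordan_block l 0 *m v) <= weighted_norm q v.
Proof.
move=> q0; rewrite /weighted_norm mulr_sumr.
have le_row (i : 'I_l) : q * (q ^+ i * `|(jordan_block l 0 *m v) i 0|) <=
    \sum_(j < l | j == i.+1 :> nat) q ^+ j * `|v j 0|.
  rewrite mulrA -exprS mxE.
  have -> : \sum_j jordan_block l 0 i j * v j 0 =
      \sum_(j < l | j == i.+1 :> nat) v j 0.
    rewrite [RHS]big_mkcond; apply: eq_bigr => j _; rewrite mxE.
    have [->|_] := eqVneq j i; last by case: ifP; rewrite ?mul1r ?mul0r.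
    by rewrite mul0r ltn_eqF.
  apply: le_trans (ler_wpM2l (exprn_ge0 _ (ltW q0)) (ler_norm_sum _ _ _)) _.
  by rewrite mulr_sumr; apply: ler_sum => j /eqP ->.
apply: le_trans (ler_sum _ (fun i _ => le_row i)) _.
rewrite (exchange_big_dep predT)//=; apply: ler_sum => j _.
(* at most one row [i] satisfies [j = i.+1], and none does when [j = 0] *)
rewrite sumr_const -mulr_natr ler_piMr ?mulr_ge0 ?exprn_ge0 ?(ltW q0)//.
rewrite lern1; apply/card_le1_eqP => i1 i2.
move=> /eqP ji1 /eqP ji2; apply: val_inj; apply: succn_inj.
by rewrite -ji1 -ji2.
Qed.

Lemma weighted_norm_jordan_block (K : numFieldType) (q lambda : K) (l : nat)
    (v : 'cV[K]_l) :
  0 < q ->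
  (`|lambda| - q^-1) * weighted_norm q v <=
    weighted_norm q (jordan_block l lambda *m v).
Proof.
move=> q0; set N := jordan_block l 0 *m v.
have leN : weighted_norm q N <= q^-1 * weighted_norm q v.
  by rewrite mulrC ler_pdivlMr// mulrC weighted_norm_nilpotent.
rewrite mulrBl; apply: le_trans (lerB (lexx _) leN) _.
rewrite /weighted_norm mulr_sumr -sumrB; apply: ler_sum => i _.
rewrite mulrCA -mulrBr ler_wpM2l ?exprn_ge0 ?(ltW q0)//.
have -> : (jordan_block l lambda *m v) i 0 = lambda * v i 0 + N i 0.
  by rewrite jordan_block_split mulmxDl mul_scalar_mx /N !mxE.
by rewrite -normrM lerB_normD.
Qed.

Definition expands (K : numFieldType) (l : nat) (c C : K) (A : 'M[K]_l) :=
  forall k (v : 'cV[K]_l), c ^+ k * `|v| <= C * `|A ^+ k *m v|.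

(** In the weighted norm one step stretches by [`|lambda| - q^-1], which
    exceeds [1] for [q] large; iterating costs no constant there, so comparing
    with the sup norm only once, at the end, keeps [C] independent of [k]. *)
Lemma jordan_block_expanding (K : numFieldType) (lambda : K) (l : nat) :
  1 < `|lambda| ->
  exists c C : K, 1 < c /\ expands c C (jordan_block l lambda).
Proof.
set m := `|lambda| => m1; have m0 : 0 < m by apply: lt_trans m1.
have m10 : 0 < m - 1 by rewrite subr_gt0.
(* any [q] with [q >= 1] and [q^-1 < m - 1] would do; this one makes both
   conditions visible, as [c - 1] becomes [(m - 1) ^+ 2 / m] *)
pose q := m / (m - 1); have q0 : 0 < q by rewrite divr_gt0.
have q1 : 1 <= q by rewrite ler_pdivlMr// mul1r gerBl.
pose c := m - q^-1.
have c1 : 1 < c.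
  rewrite -subr_gt0.
  have -> : c - 1 = (m - 1) ^+ 2 / m.
    by rewrite /c invf_div; field; rewrite lt0r_neq0.
  by rewrite divr_gt0 ?exprn_gt0.
exists c, (\sum_(i < l) q ^+ i); split=> // k v.
apply: le_trans (weighted_norm_le _ (ltW q0)).
have c0 : 0 <= c by rewrite (le_trans _ (ltW c1)).
apply: le_trans (ler_wpM2l (exprn_ge0 _ c0) (le_weighted_norm _ q1)) _.
elim: k => [|k IH]; first by rewrite !expr0 mul1r mul1mx.
rewrite !exprS -mulrA -mulmxA.
apply: le_trans (weighted_norm_jordan_block _ _ q0).
by rewrite ler_wpM2l.
Qed.

Lemma jordan_block_unit (K : fieldType) (lambda : K) (l : nat) :
  lambda != 0 -> jordan_block l lambda \in unitmx.
Proof.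
move=> lambda0; rewrite unitmxE -det_tr det_trig.
  rewrite unitfE; apply/prodf_neq0 => i _.
  by rewrite !mxE eqxx.
apply/is_trig_mxP => i j ij; rewrite !mxE -val_eqE/= !ltn_eqF//.
by rewrite ltnS ltnW.
Qed.

(** The complex numbers are only partially ordered, so the statement is carried
    over from the real case through the norm, whose values are real. *)
Lemma cvg_expr_complex (R : realType) (z : (R[i] : numFieldType)) :
  `|z| < 1 -> z ^+ n @[n --> \oo] --> 0.
Proof.
have toR (x : R[i]) : 0 <= x -> exists2 r : R, 0 <= r & x = r%:C%C.
  move=> x0; have xE := RRe_real (ger0_real x0).
  by exists (complex.Re x); rewrite // -lecR xE.
move=> z1; apply/cvgr0Pnorm_lt => e e0.
have [s s0 sE] := toR _ (normr_ge0 z); have [d d0 dE] := toR _ (ltW e0).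
have s1 : `|s| < 1 by rewrite ger0_norm// -ltcR -sE.
have {}d0 : 0 < d by rewrite -ltcR -dE.
apply: filterS (cvgr0_norm_lt _ (cvg_expr s1) _ d0) => n.
by rewrite ger0_norm ?exprn_ge0// normrX sE dE -rmorphXn ltcR.
Qed.

Lemma leq_id_increasing (k : nat -> nat) :
  {homo k : m n / (m < n)%N} -> forall n, (n <= k n)%N.
Proof. by move=> kh; elim=> // n IH; apply: leq_ltn_trans IH (kh _ _ _). Qed.

(** The norm of [u n] is at most [c ^- k n] times [C] times the norm of
    [A ^+ k n *m u n]; the first factor tends to [0] because [k n >= n], and the
    last one converges. *)
Lemma cvg0_of_expanding (K : numFieldType) (l : nat) (A : 'M[K]_l) (c C : K)
    (k : nat -> nat) (u : nat -> 'cV[K]_l) (y : 'cV[K]_l) :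
  0 < c -> c^-1 ^+ n @[n --> \oo] --> 0 ->
  expands c C A ->
  {homo k : m n / (m < n)%N} ->
  A ^+ k n *m u n @[n --> \oo] --> y -> u n @[n --> \oo] --> (0 : 'cV[K]_l).
Proof.
move=> c0 cinv expA kh uy.
have koo : k n @[n --> \oo] --> \oo.
  apply/cvgnyPge => N; near=> n.
  apply: leq_trans (leq_id_increasing kh n).
  by near: n; exact: nbhs_infty_ge.
have bound0 : c^-1 ^+ k n * (C * `|A ^+ k n *m u n|) @[n --> \oo] --> 0.
  rewrite -[X in _ --> X](mul0r (C * `|y|)).
  apply: cvgM; first exact: (cvg_comp k (GRing.exp c^-1) koo cinv).
  by apply: cvgM; [exact: cvg_cst | exact: cvg_norm].
apply/cvgr0Pnorm_lt => e e0.
apply: filterS (cvgr0_norm_lt _ bound0 _ e0) => n; apply: le_lt_trans.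
have ck0 : 0 < c ^+ k n by rewrite exprn_gt0.
rewrite normrM exprVn [`|(_ ^+ _)^-1|]gtr0_norm ?invr_gt0// mulrC.
rewrite ler_pdivlMr// mulrC ger0_norm; first exact: expA.
by apply: le_trans (expA _ _); rewrite mulr_ge0 ?exprn_ge0 ?(ltW c0).
Unshelve. all: by end_near. Qed.

Lemma extended_limit_set_expanding_neq0 (K : numFieldType) (l : nat)
    (A : 'M[K]_l) (c C : K) (x : 'cV[K]_l) :
  0 < c -> c^-1 ^+ n @[n --> \oo] --> 0 -> expands c C A -> x != 0 ->
  extended_limit_set A x = set0.
Proof.
move=> c0 cinv expA x0; apply/seteqP; split=> // y [k [u [_ kh ux uy]]].
move/eqP: x0; apply.
exact: norm_cvg_unique ux (cvg0_of_expanding c0 cinv expA kh uy).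
Qed.

Lemma extended_limit_set_expanding0 (K : numFieldType) (l : nat)
    (A : 'M[K]_l) (c C : K) :
  0 < c -> c^-1 ^+ n @[n --> \oo] --> 0 -> expands c C A -> A \in unitmx ->
  extended_limit_set A 0 = setT.
Proof.
move=> c0 cinv expA Aunit; apply/seteqP; split=> // y _.
have Aunitn n : A ^+ n \in unitmx.
  elim: n => [|n IH]; first by rewrite expr0 unitmx1.
  by rewrite exprS unitmx_mul Aunit.
have Ay n : A ^+ n.+1 *m (invmx (A ^+ n.+1) *m y) = y by rewrite mulKVmx.
have Acvg : A ^+ n.+1 *m (invmx (A ^+ n.+1) *m y) @[n --> \oo] --> y.
  by apply: cvg_near_cst; apply: nearW.
exists succn, (fun n => invmx (A ^+ n.+1) *m y); split=> //.
by apply: (cvg0_of_expanding (k := succn) c0 cinv expA _ Acvg).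
Qed.

Theorem proposition2p6 (R : realType) (l : nat) (lambda : R[i])
    (hl : (1 <= l)%N) (hlambda : 1 < `|lambda|) :
  (forall x : 'cV[R[i]]_l, x != 0 ->
     extended_limit_set (jordan_block l lambda) x = set0) /\
  extended_limit_set (jordan_block l lambda) (0 : 'cV[R[i]]_l) = setT.
Proof.
have [c [C [c1 expA]]] := jordan_block_expanding l hlambda.
have c0 : 0 < c by apply: lt_trans c1.
have cinv : `|c^-1| < 1 by rewrite gtr0_norm ?invr_gt0// invf_lt1.
have cvg0 := cvg_expr_complex cinv.
split=> [x|]; first exact: extended_limit_set_expanding_neq0 c0 cvg0 expA.
apply: (extended_limit_set_expanding0 c0 cvg0 expA).
by apply: jordan_block_unit; rewrite -normr_gt0; apply: lt_trans hlambda.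
Qed.
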